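(* For every $C>0$ there is a constant $C''>0$ depending only on $C$ such that for every positive integer $n$, every $C$-dense $n$-element point set $P$ in the plane admits a stacking order $f$ of $\mathcal{D}(P)$ with $$\mathrm{vis}(\mathcal{D}(P),f)\ge C'' n^{2/3}.$$
   Context: For a point $p$ in the plane, $D(p)$ denotes the closed disk of radius $1$ centered at $p$, and for a finite point set $P$, $\mathcal{D}(P)=\{D(p): p\in P\}$. A stacking order of a finite collection $\mathcal{D}$ of $n$ distinct unit disks is a bijection $f:\mathcal{D}\to\{1,\dots,n\}$; $f(D)$ is regarded as the height of $D$, and the arrangement is viewed from below. A point $x$ on the boundary circle of $D\in\mathcal{D}$ is visible if $x$ does not lie in any disk $D'\in\mathcal{D}$ with $f(D')<f(D)$. The visible perimeter $\mathrm{vis}(\mathcal{D},f)$ is the total length of all visible boundary points, summed over all disks of $\mathcal{D}$. An $n$-element point set $P$ is $C$-dense if $\max\{|pq|: p,q\in P\}\,/\,\min\{|pq|: p,q\in P,\ p\ne q\}\le C n^{1/2}$. *)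

(* Defs.v *)
From HB Require Import structures.
From mathcomp Require Import all_boot all_order all_algebra all_fingroup.
From mathcomp Require Import all_classical all_reals all_analysis.
Set Implicit Arguments. Unset Strict Implicit. Unset Printing Implicit Defensive.
Import Order.TTheory GRing.Theory Num.Theory.
Local Open Scope ring_scope.
Local Open Scope classical_set_scope.

Definition dist2 {R : realType} (x y : R * R) : R :=
  Num.sqrt ((x.1 - y.1) ^+ 2 + (x.2 - y.2) ^+ 2).

Definition circ_pt {R : realType} (p : R * R) (t : R) : R * R :=
  (p.1 + cos t, p.2 + sin t).

Definition in_disk {R : realType} (q x : R * R) : Prop := dist2 q x <= 1.

(* The n-point set P is given as an injective map p : 'I_n -> R*R; the
   stacking order f : {perm 'I_n} assigns heights (f i).+1 in {1..n}. *)
Definition visible_angles {R : realType} {n : nat} (p : 'I_n -> R * R)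
  (f : {perm 'I_n}) (i : 'I_n) : set R :=
  [set t | 0 <= t < 2 * pi /\
     forall j : 'I_n, (f j < f i)%N -> ~ in_disk (p j) (circ_pt (p i) t)].

(* visible perimeter: sum over all disks of the length (Lebesgue measure of
   the set of visible angles, i.e. arc length on a unit circle) *)
Definition vis {R : realType} {n : nat} (p : 'I_n -> R * R) (f : {perm 'I_n})
  : \bar R :=
  (\sum_(i < n) (@lebesgue_measure R) (visible_angles p f i))%E.

(* C-dense: max distance / min distance <= C n^(1/2); written out as
   every distance is at most C sqrt(n) times every distance between distinct points *)
Definition C_dense {R : realType} (C : R) {n : nat} (p : 'I_n -> R * R) : Prop :=
  forall a b c d : 'I_n, c != d ->
    dist2 (p a) (p b) <= C * Num.sqrt (n%:R) * dist2 (p c) (p d).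

(* Main.v *)
(* If [D(y)] is below [D(x)], the boundary point of [D(x)] in direction
   [u] is not covered by [D(y)] as soon as [(x - y) . u >= 0], whatever the scale.
   Fix a centre [c] and stack the points by increasing distance to [c].  With
   [phi x = |x - c|^2 / 2] one has
     [(x - c) . (x - y) = phi x - phi y + |x - y|^2 / 2],
   so [x] gets a visible arc of length of order [eps] around the direction
   [x - c] unless some [y] satisfies
     [|phi x - phi y| + |x - y|^2 / 2 < L eps |x - y|],
   where [L] is of the order of the diameter.  Such a conflict forces
   [|x - y| < 2 L eps], which by density leaves [O(n eps^2)] points [y] for each
   [x]; and since [phi x - phi y] is affine in [c] with gradient [y - x], only a
   fraction [O(eps)] of the centres of a square grid produce it.  For
   [eps = kappa n^(-1/3)] with [kappa] small, the average number of conflicts is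
   below [n / 2], so for some centre at least [n / 2] points are conflict-free.
   These are put at the bottom, and their arcs add up to order [n eps]. *)

Require Import Defs.
From HB Require Import structures.
From mathcomp Require Import all_boot all_order all_algebra all_fingroup.
From mathcomp Require Import all_classical all_reals all_analysis.
From mathcomp Require Import ring lra zify.
Import Order.TTheory GRing.Theory Num.Theory.
Import numFieldNormedType.Exports.
Local Open Scope ring_scope.

(** * Euclidean distance and monotonicity of length *)

Lemma dist2_ge0 (R : realType) (x y : R * R) : 0 <= dist2 x y.
Proof. exact: sqrtr_ge0. Qed.

Lemma sqr_dist2 (R : realType) (x y : R * R) :
  dist2 x y ^+ 2 = (x.1 - y.1) ^+ 2 + (x.2 - y.2) ^+ 2.
Proof. by rewrite /dist2 sqr_sqrtr // addr_ge0 // sqr_ge0. Qed.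

Lemma dist2_gt0 (R : realType) (x y : R * R) : x != y -> 0 < dist2 x y.
Proof.
move=> xy; rewrite lt_neqAle dist2_ge0 andbT eq_sym; apply: contra xy => /eqP d0.
have := sqr_dist2 _ x y; rewrite d0 expr0n /= => /esym/eqP.
rewrite paddr_eq0 ?sqr_ge0// !sqrf_eq0 !subr_eq0 => /andP[/eqP e1 /eqP e2].
by apply/eqP; case: x y e1 e2 {d0} => [a b] [c d] /= -> ->.
Qed.

Lemma dist2_ge_normr1 (R : realType) (x y : R * R) :
  `|x.1 - y.1| <= dist2 x y.
Proof.
rewrite -(ler_pXn2r (n:=2)) ?nnegrE ?dist2_ge0// sqr_dist2 real_normK ?num_real//.
by rewrite lerDl sqr_ge0.
Qed.

Lemma dist2_ge_normr2 (R : realType) (x y : R * R) :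
  `|x.2 - y.2| <= dist2 x y.
Proof.
rewrite -(ler_pXn2r (n:=2)) ?nnegrE ?dist2_ge0// sqr_dist2 real_normK ?num_real//.
by rewrite lerDr sqr_ge0.
Qed.

Lemma dist2_le_normrD (R : realType) (x y : R * R) :
  dist2 x y <= `|x.1 - y.1| + `|x.2 - y.2|.
Proof.
rewrite -(ler_pXn2r (n:=2)) ?nnegrE ?dist2_ge0 ?addr_ge0// sqr_dist2.
rewrite [leRHS]sqrrD !real_normK ?num_real// lerD2r lerDl.
by rewrite mulrn_wge0// mulr_ge0.
Qed.

(** Length is an outer measure defined on all sets, so its monotonicity applies to [visible_angles]
    without a measurability proof. *)
Lemma le_lebesgue_measure (R : realType) (A B : set R) :
  (A `<=` B)%classic -> (@lebesgue_measure R A <= @lebesgue_measure R B)%E.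
Proof.
move=> AB; rewrite /lebesgue_measure /lebesgue_stieltjes_measure.
by rewrite /measure_extension; exact: le_mu_ext.
Qed.

(** * Polar coordinates and Lipschitz bounds for sine and cosine *)

Lemma polar_form (R : realType) (x y rho : R) :
  0 <= rho -> x ^+ 2 + y ^+ 2 = rho ^+ 2 ->
  exists t : R, [/\ 0 <= t, t < 2 * pi, x = rho * cos t & y = rho * sin t].
Proof.
move=> rho0 xy; have pi0 := pi_gt0 R.
have [rz|rn0] := eqVneq rho 0.
  exists 0; rewrite rz !mul0r; move: xy; rewrite rz expr0n /= => /eqP.
  rewrite paddr_eq0 ?sqr_ge0// !sqrf_eq0 => /andP[/eqP -> /eqP ->].
  by split=> //; lra.
have rho_gt0 : 0 < rho by rewrite lt_def rn0.
pose a := x / rho; pose b := y / rho.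
have ab : a ^+ 2 + b ^+ 2 = 1.
  by rewrite /a /b !expr_div_n -mulrDl xy divff // expf_neq0.
have -> : x = rho * a by rewrite /a mulrC divfK.
have -> : y = rho * b by rewrite /b mulrC divfK.
have a1 : -1 <= a <= 1.
  by apply/andP; split; have := sqr_ge0 b; nra.
have sb : Num.sqrt (1 - a ^+ 2) = `|b|.
  by rewrite -ab addrAC subrr add0r sqrtr_sqr.
have ca : cos (acos a) = a by rewrite acosK// in_itv.
have [b0|b0] := leP 0 b.
  exists (acos a); rewrite ca sin_acos// sb ger0_norm//.
  split=> //; first exact: acos_ge0.
  by have := acos_lepi a1; lra.
have a11 : -1 <= a < 1 by nra.
have := acos_gt0 a11; have := acos_lepi a1 => h1 h2.
exists (2 * pi - acos a).
have -> : 2 * pi - acos a = - acos a + pi *+ 2 by ring.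
rewrite cosD2pi cosN sinD2pi sinN ca sin_acos// sb ltr0_norm// opprK.
by split=> //; lra.
Qed.

Lemma lipschitz_of_bounded_derive (R : realType) (f df : R -> R) :
  (forall x : R, is_derive x 1 f (df x)) -> (forall x, `|df x| <= 1) ->
  forall a b, `|f b - f a| <= `|b - a|.
Proof.
move=> fd df1.
have H a b : a < b -> `|f b - f a| <= `|b - a|.
  move=> ab.
  have cf : {within `[a, b], continuous f}%classic.
    apply: continuous_subspaceT => x; apply: differentiable_continuous.
    by apply/derivable1_diffP; case: (fd x).
  have [c _ ->] := @MVT R f df a b ab (fun x _ => fd x) cf.
  by rewrite normrM ler_piMl.
move=> a b; have [|ba|->] := ltgtP a b; first exact: H.
- by rewrite distrC (distrC b); exact: H.
- by rewrite !subrr normr0.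
Qed.

Lemma cos_lipschitz (R : realType) (a b : R) : `|cos b - cos a| <= `|b - a|.
Proof.
apply: (@lipschitz_of_bounded_derive R cos (fun x => - sin x)) => x.
by rewrite normrN ler_norml sin_geN1 sin_le1.
Qed.

Lemma sin_lipschitz (R : realType) (a b : R) : `|sin b - sin a| <= `|b - a|.
Proof.
apply: (@lipschitz_of_bounded_derive R sin cos) => x.
by rewrite ler_norml cos_geN1 cos_le1.
Qed.

(** * Visible arcs *)

(** With [u] the unit vector of angle [t], [|x + u - y|^2 = |x - y|^2 + 2 (x - y) . u + 1 > 1]. *)
Lemma not_in_disk (R : realType) (x y : R * R) (t : R) : x != y ->
  0 <= (x.1 - y.1) * cos t + (x.2 - y.2) * sin t ->
  ~ in_disk y (circ_pt x t).
Proof.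
move=> xy dot0; apply/negP; rewrite -ltNge -(ltr_pXn2r (n:=2)) ?nnegrE ?dist2_ge0//.
rewrite sqr_dist2 /= expr1n.
have := sqr_dist2 _ x y; have := dist2_gt0 _ _ _ xy; have := cos2Dsin2 t.
nra.
Qed.

(* Turning the unit vector [g / rho] by an angle at most [e / 2] changes its
   scalar product with [p i - p j] by at most [e * dist2 (p i) (p j)]. *)
Lemma visible_arc (R : realType) (n : nat) (p : 'I_n -> R * R)
    (f : {perm 'I_n}) (i : 'I_n) (g : R * R) (rho e : R) :
  injective p -> 0 <= rho -> g.1 ^+ 2 + g.2 ^+ 2 = rho ^+ 2 -> 0 < e -> e <= 1 ->
  (forall j, (f j < f i)%N ->
    0 < g.1 * ((p i).1 - (p j).1) + g.2 * ((p i).2 - (p j).2) /\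
    rho * e * dist2 (p i) (p j) <=
      g.1 * ((p i).1 - (p j).1) + g.2 * ((p i).2 - (p j).2)) ->
  ((e / 2)%:E <= lebesgue_measure (visible_angles p f i))%E.
Proof.
move=> pinj rho0 grho e0 e1 low.
have [t [t0 t2pi gx gy]] := polar_form _ _ _ _ rho0 grho.
have vis_near s : 0 <= s < 2 * pi -> `|s - t| <= e / 2 -> visible_angles p f i s.
  move=> s02 st; split=> // j fji; apply: not_in_disk.
    by rewrite inj_eq//; apply: contraTneq fji => ->; rewrite ltnn.
  have [gpos gd] := low j fji.
  set dx := (p i).1 - _ in gpos gd *; set dy := (p i).2 - _ in gpos gd *.
  have dx_le : `|dx| <= dist2 (p i) (p j) := dist2_ge_normr1 _ _ _.
  have dy_le : `|dy| <= dist2 (p i) (p j) := dist2_ge_normr2 _ _ _.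
  move: (dist2 _ _) dx_le dy_le gd => d dx_le dy_le gd.
  rewrite gx gy in gpos gd.
  have rhogt0 : 0 < rho.
    by rewrite lt_def rho0 andbT; apply: contraTneq gpos => ->; lra.
  have ut : e * d <= dx * cos t + dy * sin t.
    by rewrite -(ler_pM2l rhogt0); nra.
  have c1 : `|dx * (cos s - cos t)| <= d * (e / 2).
    by rewrite normrM ler_pM// (le_trans (cos_lipschitz _ _ _)).
  have c2 : `|dy * (sin s - sin t)| <= d * (e / 2).
    by rewrite normrM ler_pM// (le_trans (sin_lipschitz _ _ _)).
  move: c1 c2; rewrite !ler_norml => /andP[c1 _] /andP[c2 _]; nra.
have pi2 := pi_ge2 R.
(* Angles must stay in [[0, 2 pi)], so the arc extends forward from [t] in the first half-turn and
   backward in the second. *)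
pose a := if t <= pi then t else t - e / 2.
have -> : (e / 2)%:E = lebesgue_measure [set` `[a, a + e / 2]].
  rewrite lebesgue_measure_itv /= lte_fin ltrDl divr_gt0//.
  by rewrite -EFinB addrAC subrr add0r.
apply: le_lebesgue_measure => s /=; rewrite in_itv /= => /andP[as_ sa].
have [s0 s2 s3 s4] : [/\ 0 <= s, s < 2 * pi, s - t <= e / 2 & t - s <= e / 2].
  by move: as_ sa; rewrite /a; case: (leP t pi) => tp h1 h2; split; lra.
by apply: vis_near; [rewrite s0|rewrite ler_norml; apply/andP; split; lra].
Qed.

(** * Sorting, packing and grid counts *)

Lemma exists_sorting_perm (R : realType) (n : nat) (key : 'I_n -> R) :
  exists f : {perm 'I_n}, forall i j, (f j < f i)%N -> key j <= key i.
Proof.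
pose leK := [rel i j | key i <= key j].
have leK_trans : transitive leK by move=> y x z; exact: le_trans.
have leK_refl : reflexive leK by move=> x /=.
pose s := sort leK (enum 'I_n).
have sE (i : 'I_n) : i \in s by rewrite mem_sort mem_enum.
have size_s : size s = n by rewrite size_sort size_enum_ord.
have lt_s i : (index i s < n)%N by rewrite -{2}size_s index_mem.
have inj : injective (fun i => Ordinal (lt_s i)).
  by move=> i j [/index_inj]; apply.
exists (perm inj) => i j; rewrite !permE /= => /ltnW lij.
have srt : sorted leK s by apply: sort_sorted => x y; exact: le_total.
have /(_ (index j s) (index i s)) := sorted_leq_nth leK_trans leK_refl i srt.
by rewrite !inE !index_mem !nth_index//; apply.
Qed.

Lemma card_inj_ltn (n m : nat) (A : {pred 'I_n}) (u v : 'I_n -> nat) :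
  (forall j, j \in A -> (u j < m)%N /\ (v j < m)%N) ->
  {in A &, forall j k, u j = u k -> v j = v k -> j = k} ->
  (#|A| <= m * m)%N.
Proof.
case: m => [|m] uvm inj.
  rewrite leqn0; apply/eqP/eq_card0 => j; apply/negP => /uvm.
  by rewrite ltn0 => -[].
pose h j := (inord (u j) : 'I_m.+1, inord (v j) : 'I_m.+1).
have hinj : {in A &, injective h}.
  move=> j k jA kA [/(congr1 val) /= uu /(congr1 val) /= vv].
  have [uj vj] := uvm _ jA; have [uk vk] := uvm _ kA.
  by apply: inj => //; [move: uu | move: vv]; rewrite !inordK.
rewrite -(card_in_imset hinj) (leq_trans (max_card _))// card_prod card_ord //.
Qed.

(** Packing: a square cell of side [del / 2] holds at most one point. If [r < del] there is nothing
    to count; otherwise each axis meets at most [4 r / del + 1 <= 5 r / del] cells, whence the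
    25. *)
Lemma card_close_points (R : realType) (n : nat) (p : 'I_n -> R * R)
    (del r : R) (i : 'I_n) :
  0 < del -> 0 < r ->
  (forall a b : 'I_n, a != b -> del <= dist2 (p a) (p b)) ->
  #|[pred j | (i != j) && (dist2 (p i) (p j) < r)]|%:R * del ^+ 2
    <= 25 * r ^+ 2.
Proof.
move=> del0 r0 sep; have [rdel|delr] := ltP r del.
  rewrite eq_card0; first by rewrite mul0r; have := sqr_ge0 r; lra.
  move=> j; apply/negP => /andP[/sep dij]; rewrite ltNge => /negP; apply.
  by rewrite (le_trans (ltW rdel)).
(* The shift by [r] makes the cell coordinate [2 (z + r) / del] nonnegative, as truncation
   requires. *)
pose X (z : R) := 2 * z / del + 2 * r / del.
have X_itv z : `|z| < r -> 0 <= X z < 4 * r / del.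
  rewrite ltr_norml /X -mulrDl => /andP[z1 z2]; apply/andP; split.
    by rewrite divr_ge0 ?ltW//; lra.
  by rewrite ltr_pM2r ?invr_gt0//; lra.
pose m := (Num.truncn (4 * r / del)).+1.
have Xm z : `|z| < r -> (Num.truncn (X z) < m)%N.
  by move=> /X_itv/andP[_ /ltW Xz]; rewrite ltnS; exact: le_truncn.
have Xeq z w : `|z| < r -> `|w| < r -> Num.truncn (X z) = Num.truncn (X w) ->
    (z - w) ^+ 2 < del ^+ 2 / 4.
  move=> /X_itv/andP[z0 _] /X_itv/andP[w0 _] zw.
  have := truncn_itv z0; have := truncn_itv w0; rewrite zw -natr1.
  move=> /andP[h1 h2] /andP[h3 h4].
  have Xzw : X z - X w = 2 * (z - w) / del by rewrite /X; field; lra.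
  have u1 : z - w < del / 2.
    have : 2 * (z - w) / del < 1 by lra.
    by rewrite ltr_pdivrMr//; lra.
  have u2 : - (del / 2) < z - w.
    have : -1 < 2 * (z - w) / del by lra.
    by rewrite ltr_pdivlMr//; lra.
  by nra.
have cardm : (#|[pred j | (i != j) && (dist2 (p i) (p j) < r)%R]| <= m * m)%N.
  apply: (@card_inj_ltn n m _ (fun j => Num.truncn (X ((p i).1 - (p j).1)))
    (fun j => Num.truncn (X ((p i).2 - (p j).2)))) => [j|j k].
    rewrite inE => /andP[_ dij]; split; apply: Xm; apply: le_lt_trans dij.
      exact: dist2_ge_normr1.
    exact: dist2_ge_normr2.
  rewrite !inE => /andP[_ dij] /andP[_ dik].
  have b1 := le_lt_trans (dist2_ge_normr1 _ _ _) dij.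
  have b2 := le_lt_trans (dist2_ge_normr2 _ _ _) dij.
  have b3 := le_lt_trans (dist2_ge_normr1 _ _ _) dik.
  have b4 := le_lt_trans (dist2_ge_normr2 _ _ _) dik.
  move=> /(Xeq _ _ b1 b3) e1 /(Xeq _ _ b2 b4) e2.
  apply/eqP/negPn/negP => /sep djk.
  have := sqr_dist2 _ (p j) (p k); nra.
have m_le : m%:R * del <= 5 * r.
  have : (Num.truncn (4 * r / del))%:R <= 4 * r / del.
    by rewrite truncn_le divr_ge0 ?mulr_ge0 ?ltW.
  by rewrite /m -natr1 ler_pdivlMr//; lra.
apply: (@le_trans _ _ ((m%:R * del) ^+ 2)).
  by rewrite exprMn ler_wpM2r ?sqr_ge0// -natrX ler_nat.
have : 0 <= m%:R * del by rewrite mulr_ge0// ltW.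
nra.
Qed.

(** Integers in an open interval of length 4 have distinct residues modulo 4. *)
Lemma card_ord_near (R : realType) (M : nat) (b : R) :
  (#|[pred k : 'I_M | (`|b - k%:R| < 2)%R]| <= 4)%N.
Proof.
pose h (k : 'I_M) : 'I_4 := inord (k %% 4).
have hinj : {in [pred k : 'I_M | (`|b - k%:R| < 2)%R] &, injective h}.
  move=> k l; rewrite !inE !ltr_norml => /andP[k1 k2] /andP[l1 l2].
  move=> /(congr1 val); rewrite /= !inordK ?ltn_pmod// => kl.
  have kl4 : (k < l + 4)%N by rewrite -(ltr_nat R) natrD; lra.
  have lk4 : (l < k + 4)%N by rewrite -(ltr_nat R) natrD; lra.
  by apply: val_inj => /=; lia.
by rewrite -(card_in_imset hinj) (leq_trans (max_card _))// card_ord.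
Qed.

(** For fixed [l], dividing by [s * x] confines [k] to distance less than 2 from [b], because
    [d <= 2 |x|]. *)
Lemma card_grid_near_line_half (R : realType) (M : nat) (a s x y d : R) :
  0 < s -> 0 < d -> d <= 2 * `|x| ->
  (\sum_(l < M) \sum_(k < M)
    (`|a - (k%:R * s * x + l%:R * s * y)| < s * d)%R <= 4 * M)%N.
Proof.
move=> s0 d0 dx.
have -> : (4 * M = \sum_(l < M) 4)%N by rewrite sum_nat_const card_ord mulnC.
apply: leq_sum => l _; pose b := (a - l%:R * s * y) / (s * x).
rewrite (leq_trans _ (card_ord_near R M b))// -sum1_card [leqRHS]big_mkcond /=.
apply: leq_sum => k _; rewrite inE.
have x0 : x != 0 by apply: contraTneq dx => ->; rewrite normr0 mulr0 -ltNge.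
case: ltP => // ineq; case: ltP => // far; exfalso; move: far.
apply/negP; rewrite -ltNge.
have sx : 0 < s * `|x| by rewrite mulr_gt0 ?normr_gt0.
rewrite -(ltr_pM2l sx) -{1}(gtr0_norm s0) -!normrM.
have -> : s * x * (b - k%:R) = a - (k%:R * s * x + l%:R * s * y).
  by rewrite /b; field; rewrite x0 gt_eqF.
by rewrite (lt_le_trans ineq)//; nra.
Qed.

(** The larger of [|x|] and [|y|] is at least [d / 2], so the strip can be counted along rows or
    along columns. *)
Lemma card_grid_near_line (R : realType) (M : nat) (a s x y d : R) :
  0 < s -> 0 < d -> d <= `|x| + `|y| ->
  (\sum_(c : 'I_M * 'I_M)
    (`|a - (c.1%:R * s * x + c.2%:R * s * y)| < s * d)%R <= 4 * M)%N.
Proof.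
move=> s0 d0 dxy.
rewrite -(pair_bigA _ (fun k l : 'I_M =>
  (`|a - (k%:R * s * x + l%:R * s * y)| < s * d)%R : nat)) /=.
have [yx|/ltW xy] := leP `|y| `|x|.
  by rewrite exchange_big /=; apply: card_grid_near_line_half => //; lra.
under eq_bigr => k _ do under eq_bigr => l _ do rewrite [X in a - X]addrC.
by apply: card_grid_near_line_half => //; lra.
Qed.

Lemma exists_le_mean (R : realType) (T : finType) (F : T -> nat) (B : R) :
  (0 < #|T|)%N -> (\sum_t F t)%:R <= #|T|%:R * B -> exists t, (F t)%:R <= B.
Proof.
move=> /card_gt0P[t0 _] sumB; apply: contrapT => noF.
have ltB t : B < (F t)%:R by rewrite ltNge; apply/negP => h; apply: noF; exists t.
move: sumB; rewrite leNgt => /negP; apply.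
have -> : #|T|%:R * B = \sum_(t : T) B by rewrite big_const iter_addr_0 mulr_natl.
rewrite natr_sum; apply: ltr_sum => [|t _]; last exact: ltB.
by apply/hasP; exists t0; rewrite ?mem_index_enum.
Qed.

(** * Conflicts and the choice of a centre *)

(* If [x] is the point farther from [c], the left-hand side of the inequality is
   the scalar product of [x - c] and [x - y]: a conflict means that [y] lies too
   close to the tangent at [x] of the circle around [c]. *)
Definition conflict {R : realType} (s : R) (c x y : R * R) : bool :=
  (x != y) &&
  (`|dist2 x c ^+ 2 / 2 - dist2 y c ^+ 2 / 2| + dist2 x y ^+ 2 / 2
     < s * dist2 x y).

Lemma conflict_dist2 (R : realType) (s : R) (c x y : R * R) :
  conflict s c x y -> dist2 x y < 2 * s.
Proof.
move=> /andP[/dist2_gt0 d0]; set A := `|_|; have A0 : 0 <= A by exact: normr_ge0.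
move=> h; rewrite -(ltr_pM2r d0); move: h; rewrite expr2; lra.
Qed.

Lemma conflict_grid_count (R : realType) (M : nat) (s : R) (o x y : R * R) :
  0 < s -> x != y ->
  (\sum_(c : 'I_M * 'I_M)
    conflict s (o.1 + c.1%:R * s, o.2 + c.2%:R * s)%R x y <= 4 * M)%N.
Proof.
move=> s0 xy; pose a := (x.1 ^+ 2 - y.1 ^+ 2 + (x.2 ^+ 2 - y.2 ^+ 2)) / 2
  - o.1 * (x.1 - y.1) - o.2 * (x.2 - y.2).
have /(leq_trans _) := @card_grid_near_line R M a s _ _ _ s0
  (dist2_gt0 _ _ _ xy) (dist2_le_normrD _ x y); apply.
apply: leq_sum => -[k l] _; rewrite /conflict xy /=.
set z := (o.1 + _, _).
have -> : dist2 x z ^+ 2 / 2 - dist2 y z ^+ 2 / 2 =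
    a - (k%:R * s * (x.1 - y.1) + l%:R * s * (x.2 - y.2)).
  by rewrite !sqr_dist2 /a /=; field.
case: ltP => // h; case: ltP => // far; exfalso.
by have := sqr_ge0 (dist2 x y); lra.
Qed.

(** Double counting: a point has at most [25 (2 s)^2 / del^2] partners within [2 s], and each such
    pair conflicts for at most [4 M] of the [M^2] centres. Some centre does no worse than the
    average. *)
Lemma exists_center (R : realType) (n M : nat) (p : 'I_n -> R * R)
    (del s : R) (o : R * R) :
  injective p -> 0 < del -> 0 < s -> (0 < M)%N ->
  (forall a b : 'I_n, a != b -> del <= dist2 (p a) (p b)) ->
  exists k l : 'I_M,
    (\sum_i \sum_j
        conflict s (o.1 + k%:R * s, o.2 + l%:R * s)%R (p i) (p j))%:R
      * (M%:R * del ^+ 2) <= 400 * n%:R * s ^+ 2.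
Proof.
move=> pinj del0 s0 M0 sep.
pose F (c : 'I_M * 'I_M) := (\sum_i \sum_j
  conflict s (o.1 + c.1%:R * s, o.2 + c.2%:R * s)%R (p i) (p j))%N.
have M0R : 0 < M%:R :> R by rewrite ltr0n.
have Md0 : 0 < M%:R * del ^+ 2 by rewrite mulr_gt0// exprn_gt0.
suff [c Fc] : exists c, (F c)%:R <= 400 * n%:R * s ^+ 2 / (M%:R * del ^+ 2).
  by exists c.1, c.2; rewrite -ler_pdivlMr.
apply: exists_le_mean; first by rewrite card_prod card_ord muln_gt0 M0.
pose N i := #|[pred j | (i != j) && (dist2 (p i) (p j) < 2 * s)%R]|.
have sumF : (\sum_c F c <= \sum_(i < n) 4 * M * N i)%N.
  rewrite exchange_big /=; apply: leq_sum => i _.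
  rewrite exchange_big /= /N -sum1_card big_distrr /= [leqRHS]big_mkcond /=.
  apply: leq_sum => j _; rewrite inE muln1.
  case: ifPn => [/andP[ij _]|].
    by apply: conflict_grid_count => //; rewrite inj_eq.
  rewrite negb_and => far; rewrite big1// => c _.
  apply/eqP; rewrite eqb0; apply/negP => cf; move: far.
  by rewrite (conflict_dist2 _ _ _ _ _ cf); case/andP: cf; rewrite inj_eq// => ->.
apply: (@le_trans _ _ (\sum_(i < n) 4 * M * N i)%N%:R); first by rewrite ler_nat.
rewrite card_prod card_ord natr_sum.
apply: (@le_trans _ _ (\sum_(i < n) 400 * M%:R * s ^+ 2 / del ^+ 2)).
  apply: ler_sum => i _; rewrite ler_pdivlMr ?exprn_gt0//.
  have s20 : 0 < 2 * s by lra.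
  have := card_close_points _ _ _ _ _ i del0 s20 sep.
  rewrite -/(N i) !natrM -(ler_pM2l M0R); nra.
rewrite sumr_const card_ord -mulr_natl natrM le_eqVlt; apply/orP; left.
by apply/eqP; field; rewrite !gt_eqF.
Qed.

(** * From a centre to a stacking order *)

(** Points with a conflict get the key [top], above every [phi], so only points with no larger [phi]
    lie below a conflict-free one. Absence of conflict then bounds the scalar product below by
    [s |x - y|], and [s] dominates [rho e]. *)
Lemma vis_ge_center (R : realType) (n : nat) (p : 'I_n -> R * R)
    (c : R * R) (s e : R) :
  injective p -> 0 < s -> 0 < e -> e <= 1 ->
  (forall i, dist2 (p i) c * e <= s) ->
  exists f : {perm 'I_n},
    ((#|[pred i | [forall j, ~~ conflict s c (p i) (p j)]]|%:R * (e / 2))%:E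
       <= vis p f)%E.
Proof.
move=> pinj s0 e0 e1 ces.
pose Q := [pred i | [forall j, ~~ conflict s c (p i) (p j)]].
pose phi i := dist2 (p i) c ^+ 2 / 2.
have phi0 i : 0 <= phi i by rewrite divr_ge0 ?sqr_ge0.
pose top := 1 + \sum_i phi i.
have phi_top i : phi i < top.
  by rewrite /top (bigD1 i)//= addrCA ltrDl ltr_pwDl// sumr_ge0.
have [f fP] := @exists_sorting_perm R n (fun i => if i \in Q then phi i else top).
exists f; rewrite /vis -/Q.
have -> : (#|Q|%:R * (e / 2))%:E =
    (\sum_(i < n) (if i \in Q then (e / 2)%:E else 0))%E.
  by rewrite -big_mkcond /= sumEFin sumr_const mulr_natl.
apply: lee_sum => i _; case: ifP => iQ; last exact: measure_ge0.
apply: (@visible_arc R n p f i ((p i).1 - c.1, (p i).2 - c.2) (dist2 (p i) c)) => //.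
- exact: dist2_ge0.
- by rewrite sqr_dist2.
move=> j fji /=; have := fP _ _ fji; rewrite iQ.
case: ifP => jQ; last by rewrite leNgt phi_top.
move=> phij.
have pij : p i != p j by rewrite inj_eq//; apply: contraTneq fji => ->; rewrite ltnn.
have d0 := dist2_gt0 _ _ _ pij.
move: iQ; rewrite inE => /forallP/(_ j); rewrite /conflict pij /= -leNgt.
rewrite -/(phi i) -/(phi j) ger0_norm ?subr_ge0// => h.
have dotE : ((p i).1 - c.1) * ((p i).1 - (p j).1) +
    ((p i).2 - c.2) * ((p i).2 - (p j).2) = phi i - phi j + dist2 (p i) (p j) ^+ 2 / 2.
  by rewrite /phi !sqr_dist2; field.
rewrite dotE; split; first by apply: lt_le_trans h; rewrite mulr_gt0.
by apply: le_trans h; rewrite ler_wpM2r// ltW.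
Qed.

Lemma card_no_conflict (n : nat) (r : rel 'I_n) :
  (n <= #|[pred i | [forall j, ~~ r i j]]| + \sum_i \sum_j r i j)%N.
Proof.
rewrite -sum1_card [X in (X + _)%N]big_mkcond -big_split /=.
rewrite -{1}(card_ord n) -sum1_card; apply: leq_sum => i _.
rewrite inE; case: ifPn => [_|]; first by rewrite leq_addr.
by rewrite negb_forall => /existsP[j]; rewrite negbK => rij; rewrite (bigD1 j)//= rij.
Qed.

(** * Density and the final choice of constants *)

Lemma ord_le1_eq (n : nat) : (n <= 1)%N -> forall a b : 'I_n, a = b.
Proof. by move=> n1 [a la] [b lb]; apply: val_inj => /=; lia. Qed.

(** [del] is the minimum distance; with at most one point there is no pair and 1 is a
    placeholder. *)
Lemma C_dense_separation (R : realType) (C : R) (n : nat) (p : 'I_n -> R * R) :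
  injective p -> C_dense C p ->
  exists del : R, [/\ 0 < del,
    forall a b, a != b -> del <= dist2 (p a) (p b) &
    forall a b, (1 < n)%N -> dist2 (p a) (p b) <= C * Num.sqrt n%:R * del].
Proof.
move=> pinj dense; have [n1|n1] := leqP n 1.
  by exists 1; split=> // a b; rewrite (ord_le1_eq _ n1 a b) eqxx.
pose i0 : 'I_n := Ordinal (ltnW n1); pose i1 : 'I_n := Ordinal n1.
pose P := [pred ab : 'I_n * 'I_n | ab.1 != ab.2].
have P0 : P (i0, i1) by [].
have [[a b] /= ab abmin] := @arg_minP _ R _ (i0, i1) P
  (fun ab => dist2 (p ab.1) (p ab.2)) P0.
exists (dist2 (p a) (p b)); split.
- by apply: dist2_gt0; rewrite inj_eq.
- by move=> x y xy; exact: (abmin (x, y)).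
- by move=> x y _; exact: dense.
Qed.

Theorem theorem4 (R : realType) (C : R) (hC : 0 < C) :
  exists C'' : R, 0 < C'' /\
    forall (n : nat) (p : 'I_n -> R * R),
      (0 < n)%N -> injective p -> C_dense C p ->
      exists f : {perm 'I_n},
        ((C'' * powR (n%:R) (2 / 3))%:E <= vis p f)%E.
Proof.
have C20 : 0 < C ^+ 2 by rewrite exprn_gt0.
(* The bound [1 / 3] keeps the grid nonempty; the bound [1 / 100] brings the conflicts below
   [n / 2]. *)
have [kappa [kappa0 kappa1 kappaC]] :
    exists k : R, [/\ 0 < k, k <= 1 / 3 & 432 * C ^+ 2 * k <= 1 / 100].
  pose y : R := 432 * 100 * (C ^+ 2 + 1).
  have y3 : 3 <= y by rewrite /y; lra.
  have y0 : 0 < y by lra.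
  have yV : y^-1 * y = 1 by rewrite mulVf// gt_eqF.
  exists y^-1; rewrite invr_gt0; split=> //.
    by rewrite -(ler_pM2r y0) yV; lra.
  by rewrite ler_pdivrMr// /y; lra.
have kappa3 : 432 * C ^+ 2 * kappa ^+ 3 <= 1 / 100.
  have K0 : 0 <= 432 * C ^+ 2 by lra.
  have k3 : kappa ^+ 3 <= kappa.
    by rewrite exprS ler_piMr ?exprn_ile1 ?ltW//; lra.
  exact: le_trans (ler_wpM2l K0 k3) kappaC.
(* At least [n / 2] arcs of length [e / 2] give [n e / 4 = kappa q^2 / 4], where [q = n^(1/3)] and
   [e = kappa / q]. *)
exists (kappa / 4); split; first by rewrite divr_gt0.
move=> n p n0 pinj dense.
have [del [del0 sep diam]] := C_dense_separation _ _ _ _ pinj dense.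
have n1R : 1 <= n%:R :> R by rewrite ler1n.
pose q : R := powR n%:R (1 / 3).
have q1 : 1 <= q.
  by have := @ler_powR R n%:R n1R 0 (1 / 3); rewrite powRr0; apply; lra.
have q3 : q ^+ 3 = n%:R.
  by rewrite /q -powR_mulrn ?powR_ge0// -powRrM mul1r mulVf ?powRr1//; lra.
have q2 : powR n%:R (2 / 3) = q ^+ 2.
  by rewrite /q -powR_mulrn ?powR_ge0// -powRrM; congr powR; field.
have q0 : 0 < q by lra.
pose e := kappa / q.
have eq : e * q = kappa by rewrite /e divfK ?gt_eqF.
have e0 : 0 < e by rewrite divr_gt0.
have e3 : e <= 1 / 3 by rewrite /e ler_pdivrMr//; nra.
pose D := C * Num.sqrt n%:R * del.
have D0 : 0 < D by rewrite !mulr_gt0// sqrtr_gt0; lra.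
have D2 : D ^+ 2 = C ^+ 2 * n%:R * del ^+ 2.
  by rewrite /D !exprMn sqr_sqrtr//; lra.
have diamD a b : dist2 (p a) (p b) <= D.
  have [/diam//|n1] := ltnP 1 n.
  rewrite (ord_le1_eq _ n1 a b).
  by rewrite /dist2 !subrr expr0n /= addr0 sqrtr0 ltW.
(* The largest grid of step [3 D e] whose side [M s] is at most [D]; since [M >= 1], also
   [M >= 1 / (6 e)]. *)
pose M := Num.truncn (1 / (3 * e)).
have [M0 Mle Mge] : [/\ (0 < M)%N, M%:R * (3 * e) <= 1 & 1 <= M%:R * (6 * e)].
  have x0 : 0 <= 1 / (3 * e) by rewrite divr_ge0//; lra.
  have e30 : 0 < 3 * e by lra.
  have M0 : (0 < M)%N by rewrite truncn_gt0 ler_pdivlMr//; lra.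
  have M1 : 1 <= M%:R :> R by rewrite ler1n.
  have := truncn_itv x0; rewrite -/M ler_pdivlMr// ltr_pdivrMr// -natr1.
  by move=> /andP[h1 h2]; split=> //; nra.
(* Every centre lies within [3 D] of every point, so this [s] dominates [rho e]. *)
pose s := 3 * D * e.
have s0 : 0 < s by rewrite /s mulr_gt0// mulr_gt0.
pose o := p (Ordinal n0).
have [k [l conf]] := exists_center _ _ _ _ _ _ o pinj del0 s0 M0 sep.
move: conf; set c := (X in conflict s X) => conf.
have grid (m : 'I_M) : 0 <= m%:R * s <= D.
  have : (m%:R : R) <= M%:R by rewrite ler_nat ltnW.
  have : 0 <= m%:R :> R by [].
  have eD : 0 <= e * D by rewrite mulr_ge0// ltW.
  rewrite /s => m0 mM; apply/andP; split; nra.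
(* Each coordinate differs by at most [2 D], and [8 <= 9]. *)
have cD i : dist2 (p i) c <= 3 * D.
  rewrite -(ler_pXn2r (n:=2)) ?nnegrE ?dist2_ge0//; last by lra.
  have := dist2_ge_normr1 _ (p i) o; have := dist2_ge_normr2 _ (p i) o.
  move=> /le_trans/(_ (diamD _ _)) h2 /le_trans/(_ (diamD _ _)) h1.
  move: h1 h2; rewrite !ler_norml => /andP[h1 h2] /andP[h3 h4].
  have /andP[k1 k2] := grid k; have /andP[l1 l2] := grid l.
  rewrite sqr_dist2 /c /=; move: h1 h2 h3 h4 k1 k2 l1 l2.
  rewrite !opprD !addrA.
  move: (_ - o.1) (_ - o.2) (_ * s) (_ * s) => x y z w *.
  have : (x - z) ^+ 2 <= 4 * D ^+ 2 by nra.
  have : (y - w) ^+ 2 <= 4 * D ^+ 2 by nra.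
  nra.
have ces i : dist2 (p i) c * e <= s by rewrite /s ler_wpM2r// ltW.
have e1 : e <= 1 by lra.
have [f visf] := vis_ge_center _ _ _ _ _ _ pinj s0 e0 e1 ces.
exists f; apply: le_trans visf; rewrite lee_fin q2.
have := card_no_conflict n (fun i j => conflict s c (p i) (p j)).
rewrite -(ler_nat R) natrD; set A := #|_|%:R; set B := (_ : nat)%:R in conf * => nAB.
(* Here [s^2 = 9 C^2 kappa^2 q del^2], and [1 <= 6 M e] trades the factor [M] for [6 e]; the
   constant is [400 * 9 * 6 = 50 * 432]. *)
have B2 : B <= n%:R / 2.
  have s2 : s ^+ 2 = 9 * C ^+ 2 * (n%:R * (kappa ^+ 2 * q ^- 2)) * del ^+ 2.
    by rewrite /s 2!exprMn D2 /e expr_div_n; ring.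
  have nq : n%:R * (kappa ^+ 2 * q ^- 2) = kappa ^+ 2 * q.
    by rewrite -q3; field; rewrite gt_eqF.
  have BM : B * M%:R <= 400 * n%:R * (9 * C ^+ 2 * (kappa ^+ 2 * q)).
    have d20 : 0 < del ^+ 2 by rewrite exprn_gt0.
    rewrite -(ler_pM2r d20) -[X in X <= _]mulrA (le_trans conf)// s2 nq le_eqVlt.
    by apply/orP; left; apply/eqP; ring.
  have B0 : 0 <= B by [].
  have : B <= B * M%:R * (6 * e) by rewrite -mulrA ler_peMr.
  move=> /le_trans; apply.
  apply: (@le_trans _ _ (400 * n%:R * (9 * C ^+ 2 * (kappa ^+ 2 * q)) * (6 * e))).
    by rewrite ler_wpM2r//; lra.
  have -> : 400 * n%:R * (9 * C ^+ 2 * (kappa ^+ 2 * q)) * (6 * e) =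
      n%:R * (50 * (432 * C ^+ 2 * kappa ^+ 3)).
    have -> : kappa ^+ 3 = kappa ^+ 2 * (e * q) by rewrite eq -exprSr.
    by ring.
  by rewrite ler_wpM2l//; lra.
have n2A : n%:R / 2 <= A by lra.
apply: (@le_trans _ _ (n%:R / 2 * (e / 2))); last by rewrite ler_wpM2r//; lra.
by rewrite -q3 -eq le_eqVlt; apply/orP; left; apply/eqP; field.
Qed.
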